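(* Let $\alpha,\beta>-1$ be real, $0<c<1$, and let $P_n^{(-1)}$ be the monic big $-1$ Jacobi polynomials with parameters $\alpha,\beta,c$. Let $\Gamma=[-1,-c]\cup[c,1]$ and $$w^{(-1)}(x)=\theta(x)(x+1)(x-c)(1-x^2)^{(\alpha-1)/2}(x^2-c^2)^{(\beta-1)/2},$$ where $\theta(x)=x/|x|$. Then $w^{(-1)}$ is positive on the interior of $\Gamma$, all moments $\int_\Gamma w^{(-1)}(x)x^n\,dx$, $n=0,1,2,\dots$, are finite, and $$\int_\Gamma P_n^{(-1)}(x)P_m^{(-1)}(x)w^{(-1)}(x)\,dx=0\qquad\text{for all } n\neq m.$$
   Context: The monic big $-1$ Jacobi polynomials $P_n^{(-1)}(x)$ with parameters $\alpha,\beta,c$ are defined by $P_{-1}^{(-1)}=0$, $P_0^{(-1)}=1$ and $$P_{n+1}^{(-1)}(x)+b_n^{(-1)}P_n^{(-1)}(x)+u_n^{(-1)}P_{n-1}^{(-1)}(x)=xP_n^{(-1)}(x),\quad u_n^{(-1)}=A_{n-1}C_n,\quad b_n^{(-1)}=1-A_n-C_n,$$ where $$A_n=\begin{cases}\frac{(c+1)(\alpha+n+1)}{\alpha+\beta+2n+2},& n\text{ even},\\ \frac{(1-c)(\alpha+\beta+n+1)}{\alpha+\beta+2n+2},& n\text{ odd},\end{cases}\qquad C_n=\begin{cases}\frac{(1-c)n}{\alpha+\beta+2n},& n\text{ even},\\ \frac{(1+c)(\beta+n)}{\alpha+\beta+2n},& n\text{ odd},\end{cases}$$ with $C_0=0$.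 (They are the limits of the monic big $q$-Jacobi polynomials $P_n(x;a,b,c)$ for $q=-e^{\epsilon}$, $a=-e^{\epsilon\alpha}$, $b=-e^{\epsilon\beta}$, $\epsilon\to0$.) *)

(* Defs.v *)
From HB Require Import structures.
From mathcomp Require Import all_boot all_order all_algebra.
From mathcomp Require Import all_classical all_reals all_analysis.

Set Implicit Arguments.
Unset Strict Implicit.
Unset Printing Implicit Defensive.
Import Order.TTheory GRing.Theory Num.Theory.
Import numFieldNormedType.Exports.

Local Open Scope classical_set_scope.
Local Open Scope ring_scope.

Definition bigJacobi_A (R : realType) (alpha beta c : R) (n : nat) : R :=
  if odd n then (1 - c) * (alpha + beta + n%:R + 1) / (alpha + beta + 2 * n%:R + 2)
  else (c + 1) * (alpha + n%:R + 1) / (alpha + beta + 2 * n%:R + 2).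

(* The convention C_0 = 0 needs no separate clause: the numerator is 0 at n = 0
   and division is total. *)
Definition bigJacobi_C (R : realType) (alpha beta c : R) (n : nat) : R :=
  if odd n then (1 + c) * (beta + n%:R) / (alpha + beta + 2 * n%:R)
  else (1 - c) * n%:R / (alpha + beta + 2 * n%:R).

Definition bigJacobi_b (R : realType) (alpha beta c : R) (n : nat) : R :=
  1 - bigJacobi_A alpha beta c n - bigJacobi_C alpha beta c n.

(* At n = 0 the truncated predecessor gives u_0 = A_0 * C_0 = 0; the value is
   irrelevant, since u_0 only ever multiplies P_{-1} = 0. *)
Definition bigJacobi_u (R : realType) (alpha beta c : R) (n : nat) : R :=
  bigJacobi_A alpha beta c n.-1 * bigJacobi_C alpha beta c n.

(* P_{k+1} = (x - b_k) P_k - u_k P_{k-1}, with P_{-1} = 0 and P_0 = 1. *)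
Fixpoint bigJacobi (R : realType) (alpha beta c : R) (n : nat) : {poly R} :=
  if n is k.+1 then
    ('X - (bigJacobi_b alpha beta c k)%:P) * bigJacobi alpha beta c k
    - bigJacobi_u alpha beta c k *:
      (if k is j.+1 then bigJacobi alpha beta c j else 0)
  else 1.

Definition bigJacobi_supp (R : realType) (c : R) : set R :=
  `[-1, - c] `|` `[c, 1].

(* On bigJacobi_supp c both bases of the real powers are nonnegative, and positive
   except at the endpoints -1, -c, c, 1, where powR assigns finite values even
   when the exponent is negative; these four points have measure 0. *)
Definition bigJacobi_weight (R : realType) (alpha beta c : R) (x : R) : R :=
  (x / `|x|) * (x + 1) * (x - c)
  * (1 - x ^+ 2) `^ ((alpha - 1) / 2) * (x ^+ 2 - c ^+ 2) `^ ((beta - 1) / 2).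

(* Main.v *)
Require Import Defs.
From HB Require Import structures.
From mathcomp Require Import all_boot all_order all_algebra.
From mathcomp Require Import all_classical all_reals all_analysis.
From mathcomp Require Import measurable_realfun.
From mathcomp Require Import ring lra.
Import Order.TTheory GRing.Theory Num.Theory.
Import numFieldNormedType.Exports.

Local Open Scope classical_set_scope.
Local Open Scope ring_scope.

(** Write L(p) for the integral of p w over the support, and r = x^2 - c^2.
A family with a three-term recurrence is orthogonal for L as soon as L
annihilates every member of positive index ([recurrence_orthogonal]), so only
L(P_n) = 0 for n >= 1 is at stake.

The form b_n = 1 - A_n - C_n, u_n = A_{n-1} C_n of the coefficients says that
the kernel polynomials Q_n = (P_{n+1} - A_n P_n) / (x - 1) again satisfy a
three-term recurrence.  Here A_n + C_{n+1} = 1 + (-1)^n c, so its diagonal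
coefficients are just -c, c, -c, ... ([bigJacobi_kernel]).  Since
L(P_{n+1}) = A_n L(P_n) + L((x - 1) Q_n), it is enough to know L(P_1) = 0 and
L((1 - x) Q_n) = 0 for n >= 1.  For odd n this is a parity effect
([kernelJacobi_odd_moment]).  For even n = 2k the integrals of
(1 - x) r^i Q_n w, for all i at once, have a closed form with the factor
i (i - 1) ... (i - k + 1), proved by induction on k along the recurrence
([kernelJacobi_moment]); at i = 0 and k >= 1 it vanishes.  Everything is thus
reduced to three relations between moments of w
([bigJacobi_orthogonal_of_moments]).

The moment relations come from folding the left interval onto the right one by
x -> -x: L(p) becomes the integral over [c, 1] of a symmetrized polynomial
against the density (1 - x^2)^a (x^2 - c^2)^b, with a = (alpha - 1) / 2 and
b = (beta - 1) / 2 ([bigJacobi_integral]).  The derivative of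
(1 - x^2)^(a+1) (x^2 - c^2)^(b+1) q(x) integrates to 0, and q = r^i gives the
ratio of consecutive moments ([jacobi_integral_pearson],
[jacobi_integral_moment]).  As the density may blow up at both ends, this needs
a fundamental theorem of calculus for integrable derivatives that are
continuous only inside the interval ([integrable_FTC2]); integrability itself
follows by dominating the density by derivatives of monotone functions
([ge0_derive_integrable], [integrable_jacobi_density]). *)

Local Notation mu := (@lebesgue_measure _).

(** * Three-term recurrences and moments *)

Local Open Scope ring_scope.

(** The Christoffel transform of [bigJacobi] at the point 1: the monic polynomials
(P_{n+1} - A_n P_n) / (x - 1), given by the recurrence which they satisfy so that
no division of polynomials is involved. *)
Fixpoint kernelJacobi {R : realType} (alpha beta c : R) (n : nat) : {poly R} :=
  if n is k.+1 then
    ('X + ((-1) ^+ k * c)%:P) * kernelJacobi alpha beta c k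
    - (bigJacobi_A alpha beta c k * bigJacobi_C alpha beta c k) *:
      (if k is j.+1 then kernelJacobi alpha beta c j else 0)
  else 1.

Lemma bigJacobi_A_even {R : realType} (alpha beta c : R) (k : nat) :
  bigJacobi_A alpha beta c k.*2 =
  (c + 1) * (alpha + 2 * k%:R + 1) / (alpha + beta + 4 * k%:R + 2).
Proof.
by rewrite /bigJacobi_A odd_double -mul2n natrM; congr (_ * _ / _); ring.
Qed.

Lemma bigJacobi_A_odd {R : realType} (alpha beta c : R) (k : nat) :
  bigJacobi_A alpha beta c k.*2.+1 =
  (1 - c) * (alpha + beta + 2 * k%:R + 2) / (alpha + beta + 4 * k%:R + 4).
Proof.
rewrite /bigJacobi_A /= odd_double /= -mul2n -natr1 natrM.
by congr (_ * _ / _); ring.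
Qed.

Lemma bigJacobi_C_even {R : realType} (alpha beta c : R) (k : nat) :
  bigJacobi_C alpha beta c k.*2 =
  (1 - c) * (2 * k%:R) / (alpha + beta + 4 * k%:R).
Proof.
by rewrite /bigJacobi_C odd_double -mul2n natrM; congr (_ * _ / _); ring.
Qed.

Lemma bigJacobi_C_odd {R : realType} (alpha beta c : R) (k : nat) :
  bigJacobi_C alpha beta c k.*2.+1 =
  (1 + c) * (beta + 2 * k%:R + 1) / (alpha + beta + 4 * k%:R + 2).
Proof.
rewrite /bigJacobi_C /= odd_double /= -mul2n -natr1 natrM.
by congr (_ * _ / _); ring.
Qed.

(** The numerators of A_n and C_{n+1} share a factor and the sum of their other
factors is the common denominator. *)
Lemma bigJacobi_AC {R : realType} (alpha beta c : R) (n : nat) :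
  -2 < alpha + beta ->
  bigJacobi_A alpha beta c n + bigJacobi_C alpha beta c n.+1 =
  1 + (-1) ^+ n * c.
Proof.
move=> hab; have n0 : 0 <= n%:R :> R by [].
rewrite /bigJacobi_A /bigJacobi_C -signr_odd /= -natr1.
by case: (odd n) => /=; field; apply: lt0r_neq0; lra.
Qed.

(** The two halves are proved together: the first at n + 1 follows from both at n,
and then the second at n + 1 follows from the first and the recurrence of the
kernel polynomials. *)
Lemma bigJacobi_kernel {R : realType} (alpha beta c : R) (n : nat) :
  -2 < alpha + beta ->
  let P := bigJacobi alpha beta c in
  let Q := kernelJacobi alpha beta c in
  P n.+1 = bigJacobi_A alpha beta c n *: P n + ('X - 1) * Q n /\
  P n.+1 = Q n.+1 - bigJacobi_C alpha beta c n.+1 *: Q n.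
Proof.
move=> hab P Q.
have C0 : bigJacobi_C alpha beta c 0 = 0 by rewrite /bigJacobi_C /= mulr0 mul0r.
have AC k : 1 + (-1) ^+ k * c =
    bigJacobi_A alpha beta c k + bigJacobi_C alpha beta c k.+1.
  by rewrite bigJacobi_AC.
elim: n => [|n [IH1 IH2]].
  split.
    by rewrite /P /Q /= /bigJacobi_b C0 -!mul_polyC !polyCB !polyC1 polyC0; ring.
  have -> : P 1%N = 'X - (1 - bigJacobi_A alpha beta c 0)%:P.
    by rewrite /P /= /bigJacobi_b C0 -!mul_polyC; ring.
  have -> : Q 1%N = 'X + ((-1) ^+ 0 * c)%:P.
    by rewrite /Q /= C0 -!mul_polyC; ring.
  rewrite (_ : (-1) ^+ 0 * c = bigJacobi_A alpha beta c 0 + bigJacobi_C alpha beta c 1 - 1).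
    by rewrite -!mul_polyC !polyCB !polyCD !polyC1 /Q /=; ring.
  by rewrite -AC; ring.
have E1 : P n.+2 = bigJacobi_A alpha beta c n.+1 *: P n.+1 + ('X - 1) * Q n.+1.
  have -> : P n.+2 = ('X - (bigJacobi_b alpha beta c n.+1)%:P) * P n.+1
    - (bigJacobi_A alpha beta c n * bigJacobi_C alpha beta c n.+1) *: P n by [].
  have -> : Q n.+1 = P n.+1 + bigJacobi_C alpha beta c n.+1 *: Q n.
    by rewrite IH2; ring.
  have -> : ('X - 1) * (P n.+1 + bigJacobi_C alpha beta c n.+1 *: Q n) =
    ('X - 1) * P n.+1 + bigJacobi_C alpha beta c n.+1 *:
       (P n.+1 - bigJacobi_A alpha beta c n *: P n).
    rewrite (_ : P n.+1 - _ = ('X - 1) * Q n); last by rewrite IH1 [LHS]addrC addKr.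
    by rewrite -!mul_polyC; ring.
  by rewrite /bigJacobi_b -!mul_polyC !polyCM !polyCB !polyC1; ring.
split=> //; rewrite {}E1 IH2.
have -> : Q n.+2 = ('X + ((-1) ^+ n.+1 * c)%:P) * Q n.+1
   - (bigJacobi_A alpha beta c n.+1 * bigJacobi_C alpha beta c n.+1) *: Q n by [].
rewrite (_ : (-1) ^+ n.+1 * c = bigJacobi_A alpha beta c n.+1 + bigJacobi_C alpha beta c n.+2 - 1).
  by rewrite -!mul_polyC !polyCM !polyCB !polyCD !polyC1; ring.
by rewrite -AC; ring.
Qed.

(** For a scalar-valued L, rewriting with [linearZ] may also capture the additive
maps around L; this instance rewrites only under L. *)
Lemma scalarE {R : realType} (L : {scalar {poly R}}) (k : R) (p : {poly R}) :
  L (k *: p) = k * L p.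
Proof. exact: linearZ. Qed.

(** Solved form: m i times the falling factorial i (i - 1) ... (i - k + 1), divided by
the product of alpha + beta + 4 + 2 i + 2 j over j < k.  The factor i - k is read
in R, where it is negative for i < k, but a previous factor is 0 then. *)
Fixpoint kernelMoment {R : realType} (alpha beta : R) (m : nat -> R)
    (k i : nat) : R :=
  if k is j.+1 then
    kernelMoment alpha beta m j i * (i%:R - j%:R)
    / (alpha + beta + 4 + 2 * i%:R + 2 * j%:R)
  else m i.

(** In the induction of [kernelJacobi_moment] the moment at i + 1 has to be compared
with the one at i; the products of the two telescope. *)
Lemma kernelMoment_shift {R : realType} (alpha beta d : R) (m : nat -> R)
    (k i : nat) :
  -2 < alpha + beta ->
  (forall i, m i.+1 =
     d * (beta + 1 + 2 * i%:R) / (alpha + beta + 4 + 2 * i%:R) * m i) ->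
  kernelMoment alpha beta m k.+1 i.+1 =
  (i%:R + 1) * d * (beta + 1 + 2 * i%:R) * kernelMoment alpha beta m k i
  / ((alpha + beta + 4 + 2 * i%:R + 2 * k%:R)
     * (alpha + beta + 6 + 2 * i%:R + 2 * k%:R)).
Proof.
move=> hab hm; have i0 : 0 <= i%:R :> R by [].
elim: k => [|k IH].
  by rewrite /= hm -natr1; field; rewrite !lt0r_neq0//; lra.
have k0 : 0 <= k%:R :> R by [].
move: IH => /= ->; rewrite -!natr1.
by field; rewrite !lt0r_neq0//; lra.
Qed.

Lemma kernelMoment0 {R : realType} (alpha beta : R) (m : nat -> R) (k : nat) :
  kernelMoment alpha beta m k.+1 0 = 0.
Proof.
by elim: k => [|k] /=; [rewrite subrr mulr0 mul0r | move=> ->; rewrite !mul0r].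
Qed.

(** Meant for the functional that integrates (1 - x) p w.  Multiplying by x - c,
respectively by 1, turns the recurrence of the kernel polynomials into a two-term
recursion between the moments of even index and those of odd index, with i
unchanged or raised by one, so the two families have to be carried along together.
The quotient of their constants is forced: the even moment of index k + 1 must
vanish at i = k. *)
Lemma kernelJacobi_moment {R : realType} (alpha beta c : R)
    (L : {scalar {poly R}}) (k : nat) :
  -1 < alpha -> -1 < beta ->
  let rho := 'X^2 - (c ^+ 2)%:P : {poly R} in
  let Q := kernelJacobi alpha beta c in
  let m := fun i => L (rho ^+ i) in
  (forall i, m i.+1 = (1 - c ^+ 2) * (beta + 1 + 2 * i%:R)
                      / (alpha + beta + 4 + 2 * i%:R) * m i) ->
  exists e : R, forall i,
    L (rho ^+ i * Q k.*2) = e * kernelMoment alpha beta m k i /\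
    L (rho ^+ i * (('X - c%:P) * Q k.*2.+1)) =
      e * (alpha + beta + 2 * k%:R + 2) / (alpha + beta + 4 * k%:R + 2)
      * (1 - c ^+ 2) * (beta + 1 + 2 * i%:R)
      / (alpha + beta + 4 + 2 * i%:R + 2 * k%:R)
      * kernelMoment alpha beta m k i.
Proof.
move=> ha hb rho Q m hm.
have hab : -2 < alpha + beta by lra.
have rhoE : rho = ('X - c%:P) * ('X + c%:P) by rewrite /rho rmorphXn /=; ring.
have QS n : Q n.+2 = ('X + ((-1) ^+ n.+1 * c)%:P) * Q n.+1
   - (bigJacobi_A alpha beta c n.+1 * bigJacobi_C alpha beta c n.+1) *: Q n by [].
have LQ_even n i : ~~ odd n ->
    L (rho ^+ i * Q n.+2) = L (rho ^+ i * (('X - c%:P) * Q n.+1))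
      - bigJacobi_A alpha beta c n.+1 * bigJacobi_C alpha beta c n.+1
        * L (rho ^+ i * Q n).
  move=> nev; rewrite QS -signr_odd /= nev /= expr1 mulN1r polyCN.
  by rewrite mulrBr -scalerAr linearB scalarE.
have LQ_odd n i : odd n ->
    L (rho ^+ i * (('X - c%:P) * Q n.+2)) = L (rho ^+ i.+1 * Q n.+1)
      - bigJacobi_A alpha beta c n.+1 * bigJacobi_C alpha beta c n.+1
        * L (rho ^+ i * (('X - c%:P) * Q n)).
  move=> nod; rewrite QS -signr_odd /= nod /= expr0 mul1r.
  rewrite exprSr; move: (_ ^+ i) => r; rewrite rhoE -scalarE -linearB /=.
  congr (L _); rewrite -!mul_polyC; ring.
elim: k => [|k [e IH]].
  exists 1 => i; have i0 : 0 <= i%:R :> R by [].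
  split; first by rewrite /= mulr1 mul1r.
  have -> : Q 1%N = 'X + c%:P.
    by rewrite /Q /= /bigJacobi_C /= !(mulr0,mul0r) scale0r subr0 expr0 mul1r mulr1.
  rewrite -rhoE -exprSr -/(m i.+1) hm /=.
  by field; rewrite !lt0r_neq0//; lra.
have k0 : 0 <= k%:R :> R by [].
(* What remains of the difference of the two terms of the recursion once the
   factor i - k is split off. *)
exists (2 * (e * (alpha + beta + 2 * k%:R + 2) / (alpha + beta + 4 * k%:R + 2)) *
  (1 - c ^+ 2) * (alpha + 2 * k%:R + 3) / (alpha + beta + 4 + 4 * k%:R)).
have E i : L (rho ^+ i * Q (k.*2.+2)) =
  2 * (e * (alpha + beta + 2 * k%:R + 2) / (alpha + beta + 4 * k%:R + 2)) *
  (1 - c ^+ 2) * (alpha + 2 * k%:R + 3) / (alpha + beta + 4 + 4 * k%:R)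
  * kernelMoment alpha beta m k.+1 i.
  have i0 : 0 <= i%:R :> R by [].
  rewrite LQ_even ?odd_double// (IH i).1 (IH i).2.
  rewrite bigJacobi_A_odd bigJacobi_C_odd /=.
  by field; rewrite !lt0r_neq0//; lra.
move=> i; have i0 : 0 <= i%:R :> R by [].
split; first exact: E.
rewrite LQ_odd /= ?odd_double// E (IH i).2 (kernelMoment_shift _ _ _ _ _ _ hab hm).
rewrite -!doubleS bigJacobi_A_even bigJacobi_C_even /= -!natr1.
by field; rewrite !lt0r_neq0//; lra.
Qed.

(** Q_{2k} is a polynomial in x^2 and Q_{2k+1} is x + c times such a polynomial; the
functionals of interest vanish on the multiples of x + c by polynomials in x^2. *)
Lemma kernelJacobi_odd_moment {R : realType} (alpha beta c : R)
    (L : {scalar {poly R}}) (k : nat) :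
  let rho := 'X^2 - (c ^+ 2)%:P : {poly R} in
  let Q := kernelJacobi alpha beta c in
  (forall i, L (rho ^+ i * ('X + c%:P)) = 0) ->
  forall i, L (rho ^+ i * (('X + c%:P) * Q k.*2)) = 0 /\
            L (rho ^+ i * Q k.*2.+1) = 0.
Proof.
move=> rho Q h.
have rhoE : rho = ('X - c%:P) * ('X + c%:P) by rewrite /rho rmorphXn /=; ring.
have QS n : Q n.+2 = ('X + ((-1) ^+ n.+1 * c)%:P) * Q n.+1
   - (bigJacobi_A alpha beta c n.+1 * bigJacobi_C alpha beta c n.+1) *: Q n by [].
elim: k => [|k IH] i.
  rewrite /Q /= /bigJacobi_C /= !(mulr0,mul0r,scale0r,subr0) expr0 mul1r !mulr1.
  by split; exact: h.
have H j : L (rho ^+ j * (('X + c%:P) * Q k.*2.+2)) = 0.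
  rewrite QS -signr_odd /= odd_double /= expr1 mulN1r polyCN.
  set a := _ * bigJacobi_C _ _ _ _.
  rewrite (_ : _ * _ = rho ^+ j.+1 * Q k.*2.+1
                       - a *: (rho ^+ j * (('X + c%:P) * Q k.*2))).
    by rewrite linearB scalarE (IH j.+1).2 (IH j).1 mulr0 subrr.
  rewrite exprSr; move: (_ ^+ j) => r; rewrite rhoE -!mul_polyC; ring.
split; first exact: H.
rewrite [k.+1.*2]doubleS QS -signr_odd /= odd_double /= expr0 mul1r.
by rewrite mulrBr -scalerAr linearB scalarE H (IH i).2 mulr0 subrr.
Qed.

(** For m < n, lowering the index m by its recurrence leads to integrals of
x P_n P_{m-1}, and the recurrence for x P_n turns them into integrals of products
whose smaller index is m - 1 and whose indices remain distinct. *)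
Lemma recurrence_orthogonal {R : realType} (b u : nat -> R)
    (P : nat -> {poly R}) (L : {scalar {poly R}}) :
  P 0%N = 1 -> P 1%N = 'X - (b 0%N)%:P ->
  (forall n, P n.+2 = ('X - (b n.+1)%:P) * P n.+1 - u n.+1 *: P n) ->
  (forall n, L (P n.+1) = 0) ->
  forall n m, n <> m -> L (P n * P m) = 0.
Proof.
move=> P0 P1 PS LP.
suff main m n : (m < n)%N -> L (P m * P n) = 0.
  move=> n m /eqP; rewrite neq_ltn => /orP[]; first exact: main.
  by rewrite mulrC; exact: main.
have XP k : 'X * P k.+1 = P k.+2 + b k.+1 *: P k.+1 + u k.+1 *: P k.
  by rewrite PS -!mul_polyC; ring.
elim/ltn_ind: m n => -[|m] IH [//|n] mn; first by rewrite P0 mul1r LP.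
have LX : L ('X * P n.+1 * P m) = 0.
  have H k : (m < k)%N -> L (P k * P m) = 0 by rewrite mulrC; apply: IH.
  have mn1 : (m < n.+1)%N by exact: ltnW.
  rewrite XP !mulrDl -!scalerAl !linearD !scalarE.
  by rewrite (H n.+2 (leqW mn1)) (H n.+1 mn1) (H n mn) !mulr0 !addr0.
case: m => [|m] in IH mn LX *.
  rewrite P1 (_ : _ * _ = 'X * P n.+1 * P 0%N - b 0%N *: (P 0%N * P n.+1)).
    by rewrite linearB scalarE LX IH// mulr0 subrr.
  by rewrite P0 -!mul_polyC; ring.
rewrite PS (_ : _ * _ = 'X * P n.+1 * P m.+1 - b m.+1 *: (P m.+1 * P n.+1)
                        - u m.+1 *: (P m * P n.+1)).
  have mn1 : (m < n.+1)%N by exact: ltn_trans (ltnSn m) (ltnW mn).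
  rewrite 2!linearB /= !scalarE LX (IH m.+1 (ltnSn _) n.+1 (ltnW mn)).
  rewrite (IH m (ltnW (ltnSn _)) n.+1 mn1).
  by rewrite !mulr0 !subr0.
by rewrite -!mul_polyC; ring.
Qed.

Lemma scalar_functional {R : realType} (f : {poly R} -> R) :
  scalar f -> exists L : {scalar {poly R}}, L =1 f.
Proof.
move=> fL.
pose L : {scalar {poly R}} :=
  HB.pack f (GRing.isLinear.Build R {poly R} R *%R f fL).
by exists L.
Qed.

(** The hypotheses on L are the only properties of the weight that matter: the first
says L(P_1) = 0, the second is the parity relation, and the last one is the ratio
of consecutive Beta integrals. *)
Lemma bigJacobi_orthogonal_of_moments {R : realType} (alpha beta c : R)
    (L : {scalar {poly R}}) :
  -1 < alpha -> -1 < beta ->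
  let rho := 'X^2 - (c ^+ 2)%:P : {poly R} in
  L 'X = bigJacobi_b alpha beta c 0 * L 1 ->
  (forall i, L ((1 - 'X) * (rho ^+ i * ('X + c%:P))) = 0) ->
  (forall i, L ((1 - 'X) * rho ^+ i.+1) =
     (1 - c ^+ 2) * (beta + 1 + 2 * i%:R) / (alpha + beta + 4 + 2 * i%:R)
     * L ((1 - 'X) * rho ^+ i)) ->
  forall n m, n <> m ->
    L (bigJacobi alpha beta c n * bigJacobi alpha beta c m) = 0.
Proof.
move=> ha hb rho L1 Lodd Leven.
have hab : -2 < alpha + beta by lra.
have Mscalar : scalar (fun p : {poly R} => L ((1 - 'X) * p)).
  by move=> a p q; rewrite mulrDr -scalerAr linearP.
have [M ME] := scalar_functional _ Mscalar.
have MQ n : M (kernelJacobi alpha beta c n.+1) = 0.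
  rewrite -[n]odd_double_half; case: (odd n) => /=.
    have [|e /(_ 0%N) [+ _]] :=
      kernelJacobi_moment alpha beta c M n./2.+1 ha hb.
      by move=> i; rewrite !ME.
    by rewrite expr0 mul1r kernelMoment0 mulr0.
  have [|_] := kernelJacobi_odd_moment alpha beta c M n./2 _ 0.
    by move=> i; rewrite ME.
  by rewrite expr0 mul1r.
apply: (recurrence_orthogonal (bigJacobi_b alpha beta c) (bigJacobi_u alpha beta c)) => //.
  by rewrite /= mulr1 scaler0 subr0.
elim=> [|n IH].
  by rewrite /= mulr1 scaler0 subr0 -alg_polyC linearB scalarE L1 subrr.
rewrite (bigJacobi_kernel _ _ _ n.+1 hab).1 linearD scalarE IH mulr0 add0r.
by rewrite -[X in X * _]opprB mulNr linearN /= -ME MQ oppr0.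
Qed.

(** * Derivatives with endpoint singularities *)

(** [continuous_FTC2] asks for a continuous integrand on the closed interval; here f
may be unbounded at the ends.  The indefinite integral of an integrable f is still
continuous on the closed interval and has derivative f inside, so it differs from F
by a constant. *)
Lemma integrable_FTC2 {R : realType} (f F : R -> R) (a b : R) : a < b ->
  mu.-integrable `[a, b] (EFin \o f) ->
  {in `]a, b[, continuous f} ->
  (forall x, x \in `]a, b[ -> is_derive x 1 F (f x)) ->
  {within `[a, b], continuous F} ->
  \int[mu]_(x in `[a, b]) f x = F b - F a.
Proof.
move=> ab intf cf dF cF.
pose G x := \int[mu]_(t in `[a, x]) f t.
have cG : {within `[a, b], continuous G}.
  exact: parameterized_integral_continuous (ltW ab) intf.
have dG x : x \in `]a, b[ -> is_derive x 1 G (f x).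
  move=> xab; have /andP[ax xb] : a < x < b by move: xab; rewrite in_itv.
  have [dGx Gx] := continuous_FTC1_closed xb intf ax (cf _ xab).
  by rewrite -Gx derive1E; exact/derivableP.
have dD x : x \in `]a, b[ -> is_derive x 1 (F - G) (cst 0 x).
  move=> xab; have := dF _ xab; have := dG _ xab => ? ?.
  by apply: is_derive_eq; rewrite subrr.
have cD : {within `[a, b], continuous (F - G)}.
  by move=> x; apply: cvgB; [exact: cF|exact: cG].
have [z _] := MVT ab dD cD.
rewrite mul0r => /eqP; rewrite subr_eq0 => /eqP.
rewrite !fctE /G set_itv1 Rintegral_set1 subr0.
by move=> <-; ring.
Qed.

(** On the compact intervals that exhaust ]a, b[ the integral of f is an increment of
the nondecreasing function F, hence at most F b - F a; monotone convergence
carries this bound to ]a, b[. *)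
Lemma ge0_derive_integrable {R : realType} (f F : R -> R) (a b : R) : a < b ->
  {in `]a, b[, continuous f} ->
  (forall x, x \in `]a, b[ -> 0 <= f x) ->
  (forall x, x \in `]a, b[ -> is_derive x 1 F (f x)) ->
  {within `[a, b], continuous F} ->
  mu.-integrable `[a, b] (EFin \o f).
Proof.
move=> ab cf f0 dF cF.
(* The denominator is at least 3, so that the intervals are never degenerate. *)
pose e (n : nat) : R := (b - a) / n.+3%:R.
have e0 n : 0 < e n by rewrite divr_gt0// subr_gt0.
have ae n : a + e n < b - e n.
  rewrite /e -subr_gt0 (_ : _ - _ = (b - a) * (1 - 2 / n.+3%:R)); last by ring.
  by rewrite mulr_gt0 ?subr_gt0// ltr_pdivrMr// mul1r ltr_nat.
have Fhomo x y : a <= x -> x <= y -> y <= b -> F x <= F y.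
  move=> ax; rewrite le_eqVlt => /predU1P[->//|xy] yb.
  have sub : {subset `]x, y[ <= `]a, b[}.
    by move=> z; rewrite !in_itv/= => /andP[/(le_lt_trans ax)-> /lt_le_trans->].
  have [|z zxy FE] := @MVT R F f x y xy (fun z zxy => dF z (sub z zxy)).
    by apply: continuous_subspaceW cF; apply: subset_itv; rewrite bnd_simp.
  by rewrite -subr_ge0 FE mulr_ge0 ?subr_ge0 ?(ltW xy)//; apply: f0; exact: sub.
pose S n : set R := `[a + e n, b - e n]%classic.
have Soo n : S n `<=` `]a, b[.
  move=> x; rewrite /S/= !in_itv/= => /andP[h1 h2].
  by rewrite (lt_le_trans _ h1) ?ltrDl// (le_lt_trans h2)// ltrBlDr ltrDl.
have intE x y : a < x -> x < y -> y < b ->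
    (\int[mu]_(t in `[x, y]) (f t)%:E)%E = (F y - F x)%:E.
  move=> ax xy yb.
  have sub : `[x, y] `<=` `]a, b[ by apply: subset_itv; rewrite bnd_simp.
  have sub' z : z \in `]x, y[ -> z \in `]a, b[.
    by move=> /subset_itv_oo_cc/sub.
  have cfS : {within `[x, y], continuous f}.
    by apply: continuous_in_subspaceT => z; rewrite inE => /sub; exact: cf.
  have cFS : {within `[x, y], continuous F}.
    by apply: continuous_subspaceW cF => z /sub; exact: subset_itv_oo_cc.
  have iS : mu.-integrable `[x, y] (EFin \o f).
    by apply: continuous_compact_integrable => //; exact: segment_compact.
  have <- : \int[mu]_(t in `[x, y]) f t = F y - F x.
    exact (integrable_FTC2 f F x y xy iS (fun z h => cf z (sub' z h))
             (fun z h => dF z (sub' z h)) cFS).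
  by rewrite /Rintegral fineK//; apply: (integrable_fin_num _ iS).
have Sint n : (\int[mu]_(x in S n) (f x)%:E <= (F b - F a)%:E)%E.
  have h1 : a < a + e n by rewrite ltrDl.
  have h2 : b - e n < b by rewrite ltrBlDr ltrDl.
  rewrite /S (intE _ _ h1 (ae n) h2) lee_fin lerB// Fhomo//; try exact: ltW.
  - exact: ltW (lt_trans h1 (ae n)).
  - exact: ltW (lt_trans (ae n) h2).
have SU : \bigcup_n S n = `]a, b[%classic.
  apply/seteqP; split=> [x [n _ /Soo]//|x]; rewrite /= in_itv/= => /andP[ax xb].
  pose d := Num.min (x - a) (b - x).
  have d0 : 0 < d by rewrite lt_min !subr_gt0 ax.
  have [n hn] : exists n : nat, (b - a) / d <= n.+3%:R.
    exists (Num.truncn ((b - a) / d)).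
    rewrite (le_trans (ltW (truncnS_gt _)))// ler_nat.
    by rewrite ltnW.
  have : e n <= d by rewrite /e ler_pdivrMr// mulrC -ler_pdivrMr.
  rewrite le_min => /andP[h1 h2].
  by exists n => //; rewrite /S/= in_itv/=; apply/andP; split; lra.
have moo : measurable_fun `]a, b[ f.
  by apply: open_continuous_measurable_fun => // x; rewrite inE; exact: cf.
have mEoo : measurable_fun `]a, b[ (EFin \o f) by exact/measurable_EFinP.
have mE : measurable_fun `[a, b] (EFin \o f).
  by apply/measurable_EFinP/measurable_fun_itv_bndo_bndcP/measurable_fun_itv_obnd_cbndP.
have mEco : measurable_fun `[a, b[ (EFin \o f).
  by apply/measurable_EFinP/measurable_fun_itv_obnd_cbndP.
apply/integrableP; split => //.
rewrite -integral_itv_bndo_bndc; last exact: measurableT_comp.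
rewrite -integral_itv_obnd_cbnd; last exact: measurableT_comp.
rewrite (@eq_integral _ _ _ mu _ (EFin \o f)); last first.
  by move=> x; rewrite inE/= => xab; rewrite ger0_norm// f0.
have cvgS : (\int[mu]_(x in S n) (EFin \o f) x @[n --> \oo] -->
    \int[mu]_(x in \bigcup_n S n) (EFin \o f) x)%E.
  apply: ge0_nondecreasing_set_cvg_integral.
  - apply/nondecreasing_seqP => n; apply/subsetPset/subset_itv; rewrite bnd_simp.
      by rewrite lerD2l /e ler_pM2l ?subr_gt0// lef_pV2 ?posrE// ler_nat.
    by rewrite lerD2l lerN2 /e ler_pM2l ?subr_gt0// lef_pV2 ?posrE// ler_nat.
  - by move=> n; exact: measurable_itv.
  - by move=> n; apply: measurable_funS mEoo => //; exact: Soo.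
  - by move=> n x /Soo xab; rewrite lee_fin f0.
rewrite -SU -(cvg_lim _ cvgS)//; apply: (@le_lt_trans _ _ (F b - F a)%:E).
  by apply: lime_le; [apply/cvg_ex; eexists; exact: cvgS|exact: nearW].
exact: ltry.
Qed.

(** The absolute value is there because [powR] is 1 on negative bases: without it,
continuity at 0 fails. *)
Lemma continuous_powR_norm {R : realType} (p : R) : 0 < p ->
  continuous (fun u : R => `|u| `^ p).
Proof.
move=> p0 u; have [->|u0] := eqVneq u 0; last first.
  apply: (@continuous_comp _ _ _ (fun v : R => `|v|) (fun v : R => v `^ p)).
    exact: norm_continuous.
  apply: differentiable_continuous; apply/derivable1_diffP.
  by apply: derivable_powR; rewrite in_itv/= andbT normr_gt0.
suff H : `|v| `^ p @[v --> (0 : R)] --> (0 : R).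
  by rewrite /continuous_at normr0 powR0 ?gt_eqF.
apply/cvgrPdist_lt => e e0; near=> v.
rewrite sub0r normrN ger0_norm ?powR_ge0//.
rewrite -(@powRr1 _ e) ?ltW// -(mulVf (lt0r_neq0 p0)) powRrM.
rewrite gt0_ltr_powR ?nnegrE ?powR_ge0//.
near: v; exact: (@nbhs0_lt R R (e `^ p^-1) (powR_gt0 _ e0)).
Unshelve. all: by end_near. Qed.

Lemma within_continuous_horner_powR {R : realType} (p : {poly R}) (s : R)
    (A : set R) : 0 < s -> (forall x, A x -> 0 <= p.[x]) ->
  {within A, continuous (fun x => p.[x] `^ s)}.
Proof.
move=> s0 p0.
have cg : continuous (fun x => `|p.[x]| `^ s).
  move=> x; apply: (@continuous_comp _ _ _ (horner p) (fun u : R => `|u| `^ s)).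
    exact: continuous_horner.
  exact: continuous_powR_norm.
apply: (@subspace_eq_continuous _ A _ (fun x => `|p.[x]| `^ s)).
  by move=> x; rewrite inE => /p0 px; rewrite ger0_norm.
exact: continuous_subspaceT.
Qed.

Lemma is_derive_horner_powR {R : realType} (p : {poly R}) (s x : R) :
  0 < p.[x] ->
  is_derive x 1 (fun y => p.[y] `^ s) (s * p.[x] `^ (s - 1) * (p^`()).[x]).
Proof.
move=> px; have dp := is_derive_poly p x.
exact: (is_derive1_comp (is_derive1_powR s px) dp).
Qed.

Lemma continuous_horner_powR {R : realType} (p : {poly R}) (s x : R) :
  0 < p.[x] -> {for x, continuous (fun y => p.[y] `^ s)}.
Proof.
move=> px; apply: differentiable_continuous; apply/derivable1_diffP.
by have [] := is_derive_horner_powR p s x px.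
Qed.

(** The integrand is the derivative of k p^s, singular at a zero of p when s < 1; the
sign of k makes it nonnegative. *)
Lemma integrable_horner_powR {R : realType} (p : {poly R}) (s k a b : R) :
  a < b -> 0 < s ->
  (forall x, x \in `[a, b] -> 0 <= p.[x]) ->
  (forall x, x \in `]a, b[ -> 0 < p.[x]) ->
  (forall x, x \in `]a, b[ -> 0 <= k * (p^`()).[x]) ->
  mu.-integrable `[a, b]
    (EFin \o (fun x => k * (s * p.[x] `^ (s - 1) * (p^`()).[x]))).
Proof.
move=> ab s0 p0 pgt0 kp.
apply: (@ge0_derive_integrable _ _ (fun x => k * p.[x] `^ s)) => //.
- move=> x xab.
  apply: cvgM; first exact: cvg_cst.
  apply: cvgM; first by apply: cvgM; [exact: cvg_cst|exact: continuous_horner_powR (pgt0 _ xab)].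
  exact: continuous_horner.
- move=> x xab; rewrite (_ : _ * _ = s * p.[x] `^ (s - 1) * (k * (p^`()).[x])); last by ring.
  by apply: mulr_ge0; [rewrite mulr_ge0 ?powR_ge0 ?(ltW s0)|exact: kp].
- move=> x xab; have dp := is_derive_horner_powR p s x (pgt0 _ xab).
  exact: (is_deriveZ k dp).
- move=> x; apply: cvgM; first exact: cvg_cst.
  exact: within_continuous_horner_powR.
Qed.

(** * The density on the right interval *)

(** A real power is monotone, in a direction given by the sign of s; the sum covers
both cases. *)
Lemma powR_le_endpoints {R : realType} (s l u h : R) :
  0 < l -> l <= u -> u <= h -> u `^ s <= l `^ s + h `^ s.
Proof.
move=> l0 lu uh; have u0 := lt_le_trans l0 lu; have h0 := lt_le_trans u0 uh.
have [s0|s0] := leP 0 s.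
  by rewrite ler_wpDl ?powR_ge0//; apply: ge0_ler_powR => //; rewrite nnegrE ltW.
rewrite ler_wpDr ?powR_ge0// -[s]opprK !(powRN _ (- s)).
rewrite lef_pV2 ?posrE ?powR_gt0//.
by apply: ge0_ler_powR => //; rewrite ?nnegrE ?oppr_ge0 ltW.
Qed.

(** Both bases are written as polynomials, so that the results on powers of
polynomials apply to them. *)
Definition jacobi_density {R : realType} (a b c x : R) : R :=
  (1 - 'X^2).[x] `^ a * ('X^2 - (c ^+ 2)%:P).[x] `^ b.

Lemma horner_1subX2_gt0 {R : realType} (c x : R) : 0 < c ->
  x \in `]c, 1[ -> 0 < (1 - 'X^2 : {poly R}).[x].
Proof. by move=> c0; rewrite in_itv/= !hornerE => /andP[? ?]; nra. Qed.

Lemma horner_1subX2_ge0 {R : realType} (c x : R) : 0 < c ->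
  x \in `[c, 1] -> 0 <= (1 - 'X^2 : {poly R}).[x].
Proof. by move=> c0; rewrite in_itv/= !hornerE => /andP[? ?]; nra. Qed.

Lemma horner_X2subC_gt0 {R : realType} (c x : R) : 0 < c ->
  x \in `]c, 1[ -> 0 < ('X^2 - (c ^+ 2)%:P : {poly R}).[x].
Proof. by move=> c0; rewrite in_itv/= !hornerE => /andP[? ?]; nra. Qed.

Lemma horner_X2subC_ge0 {R : realType} (c x : R) : 0 < c ->
  x \in `[c, 1] -> 0 <= ('X^2 - (c ^+ 2)%:P : {poly R}).[x].
Proof. by move=> c0; rewrite in_itv/= !hornerE => /andP[? ?]; nra. Qed.

Lemma measurable_horner {R : realType} (p : {poly R}) (A : set R) :
  measurable_fun A (horner p).
Proof.
apply/measurable_funTS; apply: measurable_realfun.continuous_measurable_fun.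
exact/continuous_horner.
Qed.

Lemma measurable_jacobi_density {R : realType} (a b c : R) (A : set R) :
  measurable_fun A (jacobi_density a b c).
Proof.
have mpow (p : {poly R}) s : measurable_fun [set: R] (fun x : R => p.[x] `^ s).
  exact: (measurableT_comp (measurable_powR s) (measurable_horner p setT)).
exact: measurable_funTS (measurable_funM (mpow _ a) (mpow _ b)).
Qed.

(** The two bases add up to d = 1 - c^2, so at each point one of them lies in
[d / 2, d] and its power is bounded by a constant.  The other power, multiplied by
x / c >= 1, is a multiple of the derivative of a monotone function. *)
Lemma integrable_jacobi_density {R : realType} (a b c : R) :
  -1 < a -> -1 < b -> 0 < c -> c < 1 ->
  mu.-integrable `[c, 1] (EFin \o jacobi_density a b c).
Proof.
move=> ha hb c0 c1.
have c21 : c ^+ 2 < 1 by nra.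
pose d := 1 - c ^+ 2.
have d0 : 0 < d by rewrite subr_gt0.
pose K s := (d / 2) `^ s + d `^ s.
have K0 s : 0 <= K s by rewrite addr_ge0 ?powR_ge0.
pose u := 1 - 'X^2 : {poly R}.
pose r := 'X^2 - (c ^+ 2)%:P : {poly R}.
have ud : u^`() = - (2 *: 'X) by rewrite /u !poly.derivE sub0r -scaler_nat.
have rd : r^`() = 2 *: 'X by rewrite /r !poly.derivE subr0 -scaler_nat.
have iu : mu.-integrable `[c, 1] (EFin \o (fun x =>
    - 1 * ((a + 1) * u.[x] `^ (a + 1 - 1) * (u^`()).[x]))).
  apply: integrable_horner_powR => //.
  - by rewrite -ltrBlDr sub0r.
  - by move=> x; exact: horner_1subX2_ge0.
  - by move=> x; exact: horner_1subX2_gt0.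
  - by move=> x; rewrite in_itv/= ud !hornerE => /andP[? ?]; lra.
have ir : mu.-integrable `[c, 1] (EFin \o (fun x =>
    1 * ((b + 1) * r.[x] `^ (b + 1 - 1) * (r^`()).[x]))).
  apply: integrable_horner_powR => //.
  - by rewrite -ltrBlDr sub0r.
  - by move=> x; exact: horner_X2subC_ge0.
  - by move=> x; exact: horner_X2subC_gt0.
  - by move=> x; rewrite in_itv/= rd !hornerE => /andP[? ?]; lra.
have := integrableD _ (integrableZl _ (K b / (2 * c * (a + 1))) iu)
                      (integrableZl _ (K a / (2 * c * (b + 1))) ir).
move=> /(_ (measurable_itv _)) /(_ (measurable_itv _)) /(_ (measurable_itv _)).
apply: le_integrable => //.
  by apply/measurable_EFinP; exact: measurable_jacobi_density.
move=> x /= xcI; have /andP[cx x1] : c <= x <= 1 by move: xcI; rewrite in_itv.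
have u0 : 0 <= u.[x] by exact: horner_1subX2_ge0 c0 xcI.
have r0 : 0 <= r.[x] by exact: horner_X2subC_ge0 c0 xcI.
have uE : u.[x] = 1 - x ^+ 2 by rewrite /u !hornerE.
have rE : r.[x] = x ^+ 2 - c ^+ 2 by rewrite /r !hornerE.
have urd : u.[x] + r.[x] = d by rewrite uE rE /d; ring.
rewrite lee_fin !addrK.
rewrite ger0_norm; last by rewrite mulr_ge0 ?powR_ge0.
rewrite (le_trans _ (ler_norm _))//.
set U := u.[x] `^ a; set V := r.[x] `^ b.
have U0 : 0 <= U by exact: powR_ge0.
have V0 : 0 <= V by exact: powR_ge0.
have udx : (u^`()).[x] = - (2 * x) by rewrite ud !hornerE.
have rdx : (r^`()).[x] = 2 * x by rewrite rd !hornerE.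
rewrite [leRHS](_ : _ = (K b * U + K a * V) * (x / c)); last first.
  rewrite /= udx rdx; field; rewrite !lt0r_neq0//; lra.
have xc1 : 1 <= x / c by rewrite ler_pdivlMr// mul1r.
have S0 : 0 <= K b * U + K a * V by rewrite addr_ge0 ?mulr_ge0.
apply: le_trans (ler_peMr S0 xc1).
rewrite /jacobi_density -/u -/r -/U -/V.
have [ur|ur] := leP u.[x] r.[x].
  have VK : V <= K b by apply: powR_le_endpoints; lra.
  by rewrite ler_wpDr ?mulr_ge0// mulrC ler_wpM2r.
have UK : U <= K a by apply: powR_le_endpoints; lra.
by rewrite ler_wpDl ?mulr_ge0// ler_wpM2r.
Qed.

Lemma integrable_horner_jacobi_density {R : realType} (a b c : R) (p : {poly R}) :
  -1 < a -> -1 < b -> 0 < c -> c < 1 ->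
  mu.-integrable `[c, 1] (EFin \o (fun x => p.[x] * jacobi_density a b c x)).
Proof.
move=> ha hb c0 c1.
have [M [Mr HM]] : bounded_set (horner p @` `[c, 1]).
  apply/compact_bounded/continuous_compact; last exact: segment_compact.
  by apply: continuous_subspaceT; exact: continuous_horner.
have bp : [bounded p.[x] | x in `[c, 1]%classic].
  by exists M; split => // N MN x xcI; apply: (HM N MN); exists x.
have ij := integrable_jacobi_density a b c ha hb c0 c1.
have : mu.-integrable `[c, 1] ((EFin \o horner p) \* (EFin \o jacobi_density a b c))%E.
  apply: integrableMr; [exact: measurable_itv| |exact: bp|exact: ij].
  exact: measurable_horner.
by apply: eq_integrable => // x _; rewrite /= EFinM.
Qed.

Definition jacobi_integral {R : realType} (a b c : R) (p : {poly R}) : R :=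
  \int[mu]_(x in `[c, 1]) (p.[x] * jacobi_density a b c x).

Lemma jacobi_integral_scalar {R : realType} (a b c : R) :
  -1 < a -> -1 < b -> 0 < c -> c < 1 -> scalar (jacobi_integral a b c).
Proof.
move=> ha hb c0 c1 k p q; rewrite /jacobi_integral.
have ip := integrable_horner_jacobi_density a b c p ha hb c0 c1.
have iq := integrable_horner_jacobi_density a b c q ha hb c0 c1.
have ikp := integrable_horner_jacobi_density a b c (k *: p) ha hb c0 c1.
transitivity (\int[mu]_(x in `[c, 1]) ((k *: p).[x] * jacobi_density a b c x
    + q.[x] * jacobi_density a b c x)).
  by apply: eq_Rintegral => x _; rewrite hornerD mulrDl.
rewrite (RintegralD _ ikp iq)//.
congr (_ + _); rewrite -(RintegralZl _ _ ip)//.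
by apply: eq_Rintegral => x _; rewrite hornerZ -mulrA.
Qed.

(** The polynomial is the cofactor of the density in the derivative of
(1 - x^2)^(a+1) (x^2 - c^2)^(b+1) q(x), a function that vanishes at c and at 1. *)
Lemma jacobi_integral_pearson {R : realType} (a b c : R) (q : {poly R}) :
  -1 < a -> -1 < b -> 0 < c -> c < 1 ->
  let u := 1 - 'X^2 : {poly R} in
  let r := 'X^2 - (c ^+ 2)%:P : {poly R} in
  jacobi_integral a b c
    ((a + 1) *: (u^`() * r * q) + (b + 1) *: (u * r^`() * q) + u * r * q^`())
  = 0.
Proof.
move=> ha hb c0 c1 u r.
have a0 : 0 < a + 1 by lra.
have b0 : 0 < b + 1 by lra.
pose F x := u.[x] `^ (a + 1) * (r.[x] `^ (b + 1) * q.[x]).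
set p := (X in jacobi_integral _ _ _ X).
have pE (v s w : {poly R}) x :
    ((a + 1) *: (v^`() * s * w) + (b + 1) *: (v * s^`() * w) + v * s * w^`()).[x]
    = (a + 1) * ((v^`()).[x] * s.[x] * w.[x])
      + (b + 1) * (v.[x] * (s^`()).[x] * w.[x]) + v.[x] * s.[x] * (w^`()).[x].
  by rewrite !(hornerD, hornerM, hornerZ).
have cF : {within `[c, 1], continuous F}.
  move=> x; apply: cvgM.
    by apply: within_continuous_horner_powR => // y; exact: horner_1subX2_ge0.
  apply: cvgM.
    by apply: within_continuous_horner_powR => // y; exact: horner_X2subC_ge0.
  by apply: continuous_subspaceT; exact: continuous_horner.
have dF x : x \in `]c, 1[ -> is_derive x 1 F (p.[x] * jacobi_density a b c x).
  move=> xI.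
  have u0 : 0 < u.[x] by exact: horner_1subX2_gt0 c0 xI.
  have r0 : 0 < r.[x] by exact: horner_X2subC_gt0 c0 xI.
  have du := is_derive_horner_powR u (a + 1) x u0.
  have dr := is_derive_horner_powR r (b + 1) x r0.
  have dF := is_deriveM du (is_deriveM dr (is_derive_poly q x)).
  apply: (is_derive_eq dF).
  rewrite !fctE !addrK /jacobi_density -/u -/r (pE u r q).
  have -> : u.[x] `^ (a + 1) = u.[x] * u.[x] `^ a.
    by rewrite -(mulr_powRB1 (ltW u0) a0) addrK.
  have -> : r.[x] `^ (b + 1) = r.[x] * r.[x] `^ b.
    by rewrite -(mulr_powRB1 (ltW r0) b0) addrK.
  by rewrite /GRing.scale /=; ring.
have cf : {in `]c, 1[, continuous (fun x => p.[x] * jacobi_density a b c x)}.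
  move=> x xI.
  have u0 : 0 < u.[x] by exact: horner_1subX2_gt0 c0 xI.
  have r0 : 0 < r.[x] by exact: horner_X2subC_gt0 c0 xI.
  apply: cvgM; first exact: continuous_horner.
  exact: (continuousM (continuous_horner_powR u a x u0)
                      (continuous_horner_powR r b x r0)).
rewrite /jacobi_integral (integrable_FTC2 _ _ _ _ c1 _ cf dF cF); last first.
  exact: integrable_horner_jacobi_density.
have -> : F 1 = 0.
  by rewrite /F (_ : u.[1] = 0) ?powR0 ?mul0r ?gt_eqF// /u !hornerE; ring.
have -> : F c = 0.
  by rewrite /F (_ : r.[c] = 0) ?powR0 ?mul0r ?mulr0 ?gt_eqF// /r !hornerE; ring.
by rewrite subrr.
Qed.

(** This is the Pearson relation for q = r^i, where 1 - x^2 = (1 - c^2) - r. *)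
Lemma jacobi_integral_moment {R : realType} (a b c : R) (i : nat) :
  -1 < a -> -1 < b -> 0 < c -> c < 1 ->
  let r := 'X^2 - (c ^+ 2)%:P : {poly R} in
  let e := fun i => jacobi_integral a b c ('X * r ^+ i) in
  (a + b + 2 + i%:R) * e i.+1 = (b + 1 + i%:R) * (1 - c ^+ 2) * e i.
Proof.
move=> ha hb c0 c1 r e.
have [J JE] := scalar_functional _ (jacobi_integral_scalar a b c ha hb c0 c1).
have := jacobi_integral_pearson a b c (r ^+ i) ha hb c0 c1.
cbv zeta; rewrite -/r -JE /e -!JE.
have ud : (1 - 'X^2 : {poly R})^`() = - (2 *: 'X).
  by rewrite !poly.derivE sub0r -scaler_nat.
have rd : r^`() = 2 *: 'X by rewrite /r !poly.derivE subr0 -scaler_nat.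
have uE : 1 - 'X^2 = (1 - c ^+ 2)%:P - r :> {poly R}.
  by rewrite /r polyCB polyC1; ring.
have rid : r * (r ^+ i)^`() = (2 * i%:R) *: ('X * r ^+ i).
  rewrite deriv_exp rd; case: i => [|i] /=; first by rewrite mulr0n mulr0 mulr0 scale0r.
  rewrite exprS -mulr_natr -!mul_polyC polyCM polyC_natr; ring.
rewrite ud rd -(mulrA (1 - 'X^2) r) rid uE.
rewrite (_ : _ + _ + _ =
  (2 * ((b + 1 + i%:R) * (1 - c ^+ 2))) *: ('X * r ^+ i)
  - (2 * (a + b + 2 + i%:R)) *: ('X * r ^+ i.+1)); last first.
  by rewrite (exprS r) -!mul_polyC !(polyCM, polyCD, polyCB, polyC1); ring.
rewrite linearB !scalarE => /eqP; rewrite subr_eq0 -!mulrA.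
by rewrite (inj_eq (mulfI _)) ?pnatr_eq0// => /eqP <-.
Qed.

(** On the support the sign of x makes the weight equal to (x + 1) (x - c) times the
density on the right interval, and to (x + 1) (c - x) times the density on the
left one.  Moving the left part by x -> -x gives this polynomial. *)
Definition symmetrize {R : realType} (c : R) (p : {poly R}) : {poly R} :=
  p * (('X + 1) * ('X - c%:P)) + (p \Po - 'X) * ((1 - 'X) * ('X + c%:P)).

(** Symmetrizing (1 - x) r^i (x + c) gives 0, symmetrizing (1 - x) r^i gives
2 x (1 - x^2) r^i, and 1 and x become 2 (1 - c) x and 2 x (x^2 - c).  So all the
required moments are combinations of the integrals e_i of x r^i. *)
Lemma symmetrized_orthogonal {R : realType} (alpha beta c : R) (n m : nat) :
  -1 < alpha -> -1 < beta -> 0 < c -> c < 1 -> n <> m ->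
  jacobi_integral ((alpha - 1) / 2) ((beta - 1) / 2) c
    (symmetrize c (bigJacobi alpha beta c n * bigJacobi alpha beta c m)) = 0.
Proof.
move=> ha hb c0 c1 nm.
set a := (alpha - 1) / 2; set b := (beta - 1) / 2.
have a1 : -1 < a by rewrite /a; lra.
have b1 : -1 < b by rewrite /b; lra.
have [J JE] := scalar_functional _ (jacobi_integral_scalar a b c a1 b1 c0 c1).
have Jsym : scalar (fun p => J (symmetrize c p)).
  move=> k p q; rewrite -linearP /=; congr (J _).
  by rewrite /symmetrize comp_polyD comp_polyZ -!mul_polyC; ring.
have [L LE] := scalar_functional _ Jsym.
rewrite -JE -LE.
pose r := 'X^2 - (c ^+ 2)%:P : {poly R}.
pose e i := J ('X * r ^+ i).
have eS i : e i.+1 = (beta + 1 + 2 * i%:R) * (1 - c ^+ 2)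
                     / (alpha + beta + 2 + 2 * i%:R) * e i.
  have := jacobi_integral_moment a b c i a1 b1 c0 c1.
  cbv beta zeta; rewrite -!JE -/r -/(e i) -/(e i.+1) => ee.
  have i0 : 0 <= i%:R :> R by [].
  have ab0 : a + b + 2 + i%:R != 0 by rewrite lt0r_neq0//; lra.
  apply: (mulfI ab0); rewrite ee /a /b.
  by field; rewrite !lt0r_neq0//; lra.
have rN : r \Po - 'X = r.
  by rewrite /r comp_polyB comp_polyC comp_Xn_poly sqrrN.
have rXN i : r ^+ i \Po - 'X = r ^+ i by rewrite rmorphXn /= rN.
have oneN : 1 \Po - 'X = 1 :> {poly R} by rewrite -polyC1 comp_polyC.
have L1u i : L ((1 - 'X) * r ^+ i) = 2 * ((1 - c ^+ 2) * e i - e i.+1).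
  rewrite LE /e -scalarE -linearB -scalarE /=; congr (J _).
  rewrite /symmetrize comp_polyM rXN comp_polyB comp_polyX oneN.
  rewrite (exprS r); move: (r ^+ i) => s; rewrite /r -!mul_polyC polyCB polyC1.
  by rewrite rmorphXn /= polyC_natr; ring.
apply: bigJacobi_orthogonal_of_moments => //.
- have -> : L 'X = 2 * (e 1%N + (c ^+ 2 - c) * e 0%N).
    rewrite LE /e -scalarE -linearD -scalarE /=; congr (J _).
    rewrite /symmetrize comp_polyX expr0 expr1 /r -!mul_polyC polyCB.
    by rewrite rmorphXn /= polyC_natr; ring.
  have -> : L 1 = 2 * (1 - c) * e 0%N.
    rewrite LE /e -scalarE /=; congr (J _).
    by rewrite /symmetrize oneN expr0 -!mul_polyC polyCM polyCB polyC1 polyC_natr; ring.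
  rewrite eS /bigJacobi_b /bigJacobi_A /bigJacobi_C /= !(mulr0, mul0r, addr0, subr0).
  by field; rewrite !lt0r_neq0//; lra.
- move=> i; rewrite LE (_ : symmetrize _ _ = 0) ?linear0//.
  rewrite -/r /symmetrize !comp_polyM rXN comp_polyB comp_polyD comp_polyX.
  by rewrite oneN comp_polyC; ring.
- move=> i; rewrite -/r !L1u !eS -natr1.
  have i0 : 0 <= i%:R :> R by [].
  by field; rewrite !lt0r_neq0//; lra.
Qed.

(** * Reflection, and the weight on both intervals *)

(** [lebesgue_measureN] identifies the two measures on measurable sets only, which is
all that an integral sees. *)
Lemma integral_lebesgue_pushforwardN {R : realType} (f : R -> \bar R) (a b : R) :
  (\int[mu]_(x in `[(- b)%R, (- a)%R]) f x =
   \int[pushforward mu (-%R : measurableTypeR R -> measurableTypeR R)]_(x in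
     `[(- b)%R, (- a)%R]) f x)%E.
Proof.
by apply: eq_measure_integral => A mA _ /=; exact/esym/lebesgue_measureN.
Qed.

Lemma preimageN_itvcc {R : realType} (a b : R) :
  (-%R : measurableTypeR R -> measurableTypeR R) @^-1` `[- b, - a] = `[a, b]%classic.
Proof. by rewrite opp_preimage_itvbndbnd/= !opprK. Qed.

Lemma integrable_reflect {R : realType} (f : R -> R) (a b : R) :
  measurable_fun [set: R] f ->
  mu.-integrable `[a, b] (EFin \o (f \o -%R)) ->
  mu.-integrable `[- b, - a] (EFin \o f).
Proof.
move=> mf /integrableP[_ foo]; apply/integrableP; split.
  by apply/measurable_EFinP; exact: measurable_funTS.
rewrite integral_lebesgue_pushforwardN ge0_integral_pushforward//=.
  by rewrite preimageN_itvcc.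
by apply/measurable_EFinP; apply: measurableT_comp => //; exact: measurable_funTS.
Qed.

Lemma integral_reflect {R : realType} (f : R -> R) (a b : R) :
  measurable_fun [set: R] f ->
  mu.-integrable `[a, b] (EFin \o (f \o -%R)) ->
  \int[mu]_(x in `[- b, - a]) f x = \int[mu]_(x in `[a, b]) f (- x).
Proof.
move=> mf intf; rewrite /Rintegral; congr fine.
rewrite integral_lebesgue_pushforwardN integral_pushforward//=.
- by rewrite preimageN_itvcc.
- exact/measurable_EFinP.
- by rewrite preimageN_itvcc.
Qed.

Lemma integrable_disjoint_setU {d : measure_display} {T : measurableType d}
    {R : realType} (m : {measure set T -> \bar R}) (A B : set T) (f : T -> \bar R) :
  measurable A -> measurable B -> [disjoint A & B]%classic ->
  m.-integrable A f -> m.-integrable B f -> m.-integrable (A `|` B) f.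
Proof.
move=> mA mB AB /integrableP[mfA fA] /integrableP[mfB fB].
have mf : measurable_fun (A `|` B) f by exact/measurable_funU.
apply/integrableP; split => //; rewrite ge0_integral_setU//.
  exact: lte_add_pinfty.
exact: measurableT_comp.
Qed.

Lemma jacobi_densityE {R : realType} (a b c x : R) :
  jacobi_density a b c x = (1 - x ^+ 2) `^ a * (x ^+ 2 - c ^+ 2) `^ b.
Proof. by rewrite /jacobi_density !hornerE. Qed.

Lemma bigJacobi_weight_right {R : realType} (alpha beta c x : R) :
  0 < c -> x \in `[c, 1] ->
  bigJacobi_weight alpha beta c x =
  ((x + 1) * (x - c)) * jacobi_density ((alpha - 1) / 2) ((beta - 1) / 2) c x.
Proof.
move=> c0; rewrite in_itv/= => /andP[cx _].
have x0 : 0 < x by exact: lt_le_trans cx.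
rewrite /bigJacobi_weight jacobi_densityE gtr0_norm// divff ?gt_eqF// mul1r.
by rewrite !mulrA.
Qed.

Lemma bigJacobi_weight_left {R : realType} (alpha beta c x : R) :
  0 < c -> x \in `[- 1, - c] ->
  bigJacobi_weight alpha beta c x =
  ((x + 1) * (c - x)) * jacobi_density ((alpha - 1) / 2) ((beta - 1) / 2) c x.
Proof.
move=> c0; rewrite in_itv/= => /andP[_ xc].
have x0 : x < 0 by rewrite (le_lt_trans xc)// oppr_lt0.
rewrite /bigJacobi_weight jacobi_densityE ltr0_norm// invrN mulrN divff ?lt_eqF//.
by rewrite -[c - x]opprB mulN1r mulrN !mulNr !mulrA.
Qed.

Lemma jacobi_densityN {R : realType} (a b c x : R) :
  jacobi_density a b c (- x) = jacobi_density a b c x.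
Proof. by rewrite !jacobi_densityE sqrrN. Qed.

Lemma bigJacobi_integral {R : realType} (alpha beta c : R) (p : {poly R}) :
  -1 < alpha -> -1 < beta -> 0 < c -> c < 1 ->
  let f x := p.[x] * bigJacobi_weight alpha beta c x in
  mu.-integrable (bigJacobi_supp c) (EFin \o f) /\
  \int[mu]_(x in bigJacobi_supp c) f x =
    jacobi_integral ((alpha - 1) / 2) ((beta - 1) / 2) c (symmetrize c p).
Proof.
move=> ha hb c0 c1 f.
set a := (alpha - 1) / 2; set b := (beta - 1) / 2.
have a1 : -1 < a by rewrite /a; lra.
have b1 : -1 < b by rewrite /b; lra.
pose pr := p * (('X + 1) * ('X - c%:P)).
pose pl := p * (('X + 1) * (c%:P - 'X)).
pose gl x := pl.[x] * jacobi_density a b c x.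
have int_pr := integrable_horner_jacobi_density a b c pr a1 b1 c0 c1.
have int_pl := integrable_horner_jacobi_density a b c (pl \Po - 'X) a1 b1 c0 c1.
have plN x : (pl \Po - 'X).[x] = pl.[- x] by rewrite horner_comp !hornerE.
have fr x : x \in `[c, 1]%classic -> f x = pr.[x] * jacobi_density a b c x.
  rewrite inE => xr; rewrite /f bigJacobi_weight_right// mulrA; congr (_ * _).
  by rewrite /pr !hornerM; congr (_ * (_ * _)); rewrite !hornerE.
have fl x : x \in `[- 1, - c]%classic -> f x = gl x.
  rewrite inE => xl; rewrite /f /gl bigJacobi_weight_left// mulrA; congr (_ * _).
  by rewrite /pl !hornerM; congr (_ * (_ * _)); rewrite !hornerE.
have mgl : measurable_fun [set: R] gl.
  apply: measurable_funM; first exact: measurable_horner.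
  exact: measurable_jacobi_density.
have glN : mu.-integrable `[c, 1] (EFin \o (gl \o -%R)).
  by apply: eq_integrable int_pl => // x _ /=; rewrite plN /gl jacobi_densityN.
have igl : mu.-integrable `[- 1, - c] (EFin \o f).
  apply: eq_integrable (integrable_reflect gl c 1 mgl glN) => // x xl.
  by rewrite /= fl.
have ir : mu.-integrable `[c, 1] (EFin \o f).
  by apply: eq_integrable int_pr => // x xr; rewrite /= fr.
have disj : [disjoint `[- 1, - c]%classic & `[c, 1]%classic]%classic.
  apply/disj_set2P; apply/seteqP; split => // x [] /=.
  by rewrite !in_itv/= => /andP[_ ?] /andP[? _]; lra.
have iU : mu.-integrable (bigJacobi_supp c) (EFin \o f).
  by apply: integrable_disjoint_setU.
split; first exact: iU.
rewrite /bigJacobi_supp (Rintegral_setU _ _ iU disj); [|exact: measurable_itv..].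
have [J JE] := scalar_functional _ (jacobi_integral_scalar a b c a1 b1 c0 c1).
rewrite -JE /symmetrize linearD addrC /=; congr (_ + _).
  by rewrite JE; apply: eq_Rintegral => x; exact: fr.
transitivity (\int[mu]_(x in `[- 1, - c]) gl x).
  by apply: eq_Rintegral => x; exact: fl.
rewrite (integral_reflect gl c 1 mgl glN) JE.
apply: eq_Rintegral => x _; rewrite /gl jacobi_densityN -plN; congr (_.[x] * _).
rewrite /pl !comp_polyM comp_polyB comp_polyD comp_polyX comp_polyC.
by rewrite -polyC1 comp_polyC polyC1; ring.
Qed.

(** An interior point is not an end point: otherwise the points x - d and x + d would
not both be in the support. *)
Lemma bigJacobi_weight_gt0 {R : realType} (alpha beta c x : R) :
  0 < c -> interior (bigJacobi_supp c) x -> 0 < bigJacobi_weight alpha beta c x.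
Proof.
move=> c0 xI.
have [e /= e0 He] : exists2 e : R, 0 < e & forall y, `|x - y| < e -> bigJacobi_supp c y.
  by move: xI => /nbhs_ballP[e e0 He]; exists e => // y; exact: He.
(* d <= c prevents x + d and x - d from crossing the gap ]-c, c[. *)
pose d := Num.min (e / 2) c.
have d0 : 0 < d by rewrite lt_min c0 divr_gt0.
have dc : d <= c by rewrite ge_min lexx orbT.
have de : d < e.
  by rewrite gt_min ltr_pdivrMr// ltr_pMr// ltr1n.
have := interior_subset xI.
have hp : bigJacobi_supp c (x + d).
  by apply: He; rewrite opprD addNKr normrN gtr0_norm.
have hm : bigJacobi_supp c (x - d).
  by apply: He; rewrite opprB addrC subrK gtr0_norm.
move: hp hm; rewrite /bigJacobi_supp /= !in_itv/=.
move=> hp hm [xl|xr].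
  have /andP[h1 h2] := xl.
  have [h3 h4] : -1 < x /\ x < - c.
    by case: hp hm => /andP[? ?] [] /andP[? ?]; split; lra.
  have u0 : 0 < (1 - x) * (1 + x) by rewrite mulr_gt0//; lra.
  have r0 : 0 < (- c - x) * (c - x) by rewrite mulr_gt0//; lra.
  rewrite bigJacobi_weight_left// jacobi_densityE.
  by rewrite !mulr_gt0 ?powR_gt0//; lra.
have /andP[h1 h2] := xr.
have [h3 h4] : c < x /\ x < 1.
  by case: hp hm => /andP[? ?] [] /andP[? ?]; split; lra.
have u0 : 0 < (1 - x) * (1 + x) by rewrite mulr_gt0//; lra.
have r0 : 0 < (x - c) * (x + c) by rewrite mulr_gt0//; lra.
rewrite bigJacobi_weight_right// jacobi_densityE.
by rewrite !mulr_gt0 ?powR_gt0//; lra.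
Qed.

Theorem mainTheorem4 (R : realType) (alpha beta c : R)
    (halpha : -1 < alpha) (hbeta : -1 < beta) (hc0 : 0 < c) (hc1 : c < 1) :
  (forall x : R, interior (bigJacobi_supp c) x ->
     0 < bigJacobi_weight alpha beta c x) /\
  (forall n : nat,
     (@lebesgue_measure R).-integrable (bigJacobi_supp c)
       (fun x : R => (bigJacobi_weight alpha beta c x * x ^+ n)%:E)) /\
  (forall n m : nat, n <> m ->
     (\int[@lebesgue_measure R]_(x in bigJacobi_supp c)
        ((bigJacobi alpha beta c n).[x] * (bigJacobi alpha beta c m).[x]
         * bigJacobi_weight alpha beta c x)%:E)%E = 0%E).
Proof.
have mG : measurable (bigJacobi_supp c) by exact: measurableU.
split; [|split].
- by move=> x; exact: bigJacobi_weight_gt0.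
- move=> n.
  have [iX _] := bigJacobi_integral alpha beta c 'X^n halpha hbeta hc0 hc1.
  by apply: eq_integrable iX => // x _ /=; rewrite hornerXn mulrC.
- move=> n m nm.
  have [iP IP] := bigJacobi_integral alpha beta c
    (bigJacobi alpha beta c n * bigJacobi alpha beta c m) halpha hbeta hc0 hc1.
  rewrite symmetrized_orthogonal// in IP.
  transitivity (\int[@lebesgue_measure R]_(x in bigJacobi_supp c)
    ((bigJacobi alpha beta c n * bigJacobi alpha beta c m).[x]
     * bigJacobi_weight alpha beta c x)%:E)%E.
    by apply: eq_integral => x _; rewrite hornerM.
  rewrite -[LHS]fineK; first by rewrite [fine _]IP.
  by apply: (integrable_fin_num _ iP).
Qed.
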